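(* Let $\kappa>0$ and let $w(t)=t^\alpha e^{-\delta t}$ on $(0,\infty)$ with $\delta\geq0$. Assume $\alpha<1$, $\alpha<\beta$, $\alpha<2\beta-1$, and let the $\gamma_j>0$ be pairwise distinct for $j=1,\dots,n$. Then the Gram matrix $A(\gamma)$ is invertible, and we set $u(\gamma):=A(\gamma)^{-1}b(\gamma)$. Then: (1) The quantities in the quadratic form satisfy $$a=\Gamma(2\beta-1-\alpha)\,(2\kappa^2+\delta)^{-(2\beta-1-\alpha)},$$ $$b_j(\gamma)=\Gamma(\beta-\alpha)\,(2\kappa^2+\gamma_j+\delta)^{-(\beta-\alpha)},\qquad A_{jk}(\gamma)=\Gamma(1-\alpha)\,(2\kappa^2+\gamma_j+\gamma_k+\delta)^{-(1-\alpha)}.$$ (2) The reduced objective $\widehat{\mathcal{J}}_n$ has gradient $$\partial_{\gamma_i}\widehat{\mathcal{J}}_n(\gamma)=-2\,(\partial_{\gamma_i}b(\gamma))^Tu(\gamma)+u(\gamma)^T(\partial_{\gamma_i}A(\gamma))u(\gamma).$$ Hence $$\partial_{\gamma_i}\widehat{\mathcal{J}}_n(\gamma)=2(\beta-\alpha)\Gamma(\beta-\alpha)(2\kappa^2+\gamma_i+\delta)^{-(\beta-\alpha+1)}u_i-2(1-\alpha)\Gamma(1-\alpha)\,u_i\sum_{k=1}^nu_k\,(2\kappa^2+\gamma_i+\gamma_k+\delta)^{-(2-\alpha)}.$$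
   Context: Here $\beta>0$, $\gamma=(\gamma_1,\dots,\gamma_n)$, and $\langle u,v\rangle_{w^{-1}}=\int_0^\infty u(t)v(t)\,\frac{dt}{w(t)}$, $\|u\|_{w^{-1}}^2=\langle u,u\rangle_{w^{-1}}$. Put $f_{\beta,\kappa}(t)=t^{\beta-1}e^{-\kappa^2t}$ and $e_j^\gamma(t)=e^{-(\kappa^2+\gamma_j)t}$. The quantities of the quadratic form are $$a=\|f_{\beta,\kappa}\|_{w^{-1}}^2,\qquad b_j(\gamma)=\langle f_{\beta,\kappa},e_j^\gamma\rangle_{w^{-1}},\qquad A_{jk}(\gamma)=\langle e_j^\gamma,e_k^\gamma\rangle_{w^{-1}},\qquad j,k=1,\dots,n,$$ and the reduced objective is $$\widehat{\mathcal{J}}_n(\gamma)=\min_{c\in\mathbb{R}^n}\int_0^\infty\Big|f_{\beta,\kappa}(t)-\sum_{j=1}^nc_je_j^\gamma(t)\Big|^2\frac{dt}{w(t)}=a-b(\gamma)^TA(\gamma)^{-1}b(\gamma).$$ In the last formula $u_i$ denotes the $i$-th component of $u(\gamma)$.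
   Formalization: The weight is taken as w(t)=t^α e^{δt} instead of t^α e^{-δt}, since the printed formulas fail for δ>0 (α=0, β=κ=δ=1 gives a=1, not 1/3); δ≥0 is relaxed to δ>-2κ², so the printed weight is covered with 2κ²-δ in the formulas. *)

(* Defs.v *)
From HB Require Import structures.
From mathcomp Require Import all_boot all_order all_algebra.
From mathcomp Require Import all_classical all_reals all_analysis.

Set Implicit Arguments.
Unset Strict Implicit.
Unset Printing Implicit Defensive.

Import Order.TTheory GRing.Theory Num.Theory.
Import numFieldNormedType.Exports.

Local Open Scope classical_set_scope.
Local Open Scope ring_scope.

(* Euler's integral; meaningful for s > 0 only. *)
Definition Gamma (R : realType) (s : R) : R :=
  \int[lebesgue_measure]_(t in `]0, +oo[) (t `^ (s - 1) * expR (- t)).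

(* The sign of delta is the one for which 1 / w(t) = t^-alpha e^(-delta t), as
   the closed forms in 2 kappa^2 + delta require.  A negative delta gives the
   exponentially decaying weights t^alpha e^(- |delta| t). *)
Definition weight (R : realType) (alpha delta t : R) : R :=
  t `^ alpha * expR (delta * t).

(* On ]0, +oo[, with measure dt / w(t). *)
Definition inner (R : realType) (w u v : R -> R) : R :=
  \int[lebesgue_measure]_(t in `]0, +oo[) (u t * v t / w t).

Definition f_target (R : realType) (beta kappa t : R) : R :=
  t `^ (beta - 1) * expR (- (kappa ^+ 2 * t)).

Definition e_fun (R : realType) (kappa : R) (n : nat) (g : 'rV[R]_n) (j : 'I_n)
    (t : R) : R :=
  expR (- ((kappa ^+ 2 + g 0 j) * t)).

Definition a_coef (R : realType) (alpha beta delta kappa : R) : R :=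
  inner (weight alpha delta) (f_target beta kappa) (f_target beta kappa).

Definition b_vec (R : realType) (alpha beta delta kappa : R) (n : nat)
    (g : 'rV[R]_n) : 'cV[R]_n :=
  \col_j inner (weight alpha delta) (f_target beta kappa) (e_fun kappa g j).

Definition A_mx (R : realType) (alpha delta kappa : R) (n : nat)
    (g : 'rV[R]_n) : 'M[R]_n :=
  \matrix_(j, k) inner (weight alpha delta) (e_fun kappa g j) (e_fun kappa g k).

Definition u_vec (R : realType) (alpha beta delta kappa : R) (n : nat)
    (g : 'rV[R]_n) : 'cV[R]_n :=
  invmx (A_mx alpha delta kappa g) *m b_vec alpha beta delta kappa g.

(* Extended-real valued, so that a divergent integral counts as +oo and not as
   the junk value 0 of Rintegral. *)
Definition objective (R : realType) (alpha beta delta kappa : R) (n : nat)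
    (g : 'rV[R]_n) (c : 'cV[R]_n) : \bar R :=
  (\int[lebesgue_measure]_(t in `]0%R, +oo[)
    (`|f_target beta kappa t - \sum_(j < n) c j 0 * e_fun kappa g j t| ^+ 2
       / weight alpha delta t)%R%:E)%E.

Definition J_hat (R : realType) (alpha beta delta kappa : R) (n : nat)
    (g : 'rV[R]_n) : R :=
  fine (ereal_inf (range (objective alpha beta delta kappa g))).

(* The coordinate direction along which 'D_(dir i) is the partial derivative
   with respect to the i-th entry. *)
Definition dir (R : realType) (n : nat) (i : 'I_n) : 'rV[R]_n := delta_mx 0 i.

(* Main.v *)
Require Import Defs.
From HB Require Import structures.
From mathcomp Require Import all_boot all_order all_algebra.
From mathcomp Require Import all_classical all_reals all_analysis.
From mathcomp Require Import measurable_realfun.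
From mathcomp Require Import ring lra.

Set Implicit Arguments.
Unset Strict Implicit.
Unset Printing Implicit Defensive.

Import Order.TTheory GRing.Theory Num.Theory.
Import numFieldNormedType.Exports.

Local Open Scope classical_set_scope.
Local Open Scope ring_scope.

(** The weight turns every inner product at hand into Euler's integral: a product
    of two functions t^r e^(-p t), divided by w, is again of the form
    t^(s-1) e^(-p t), and the substitution t -> t/p gives Gamma(s) p^(-s)
    ([laplace_powR], [inner_powR_expR]).  The convergence of Euler's integral
    ([integrable_gamma]) is what allows the objective to be expanded as a
    quadratic polynomial in c.

    Since c^T A c is the squared norm of sum_j c_j e_j, the matrix A is positive
    definite as soon as the exponentials e_j are linearly independent, that is,
    as soon as the rates are distinct ([expR_free], [A_mx_posdef]).  Completing
    the square at u = A^-1 b then gives the minimum a - b^T A^-1 b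
    ([complete_square], [objective_min]).

    For the gradient, positivity and distinctness of the g_j are open conditions,
    so near g the closed forms hold and J = a - b^T u with A u = b.  Cramer's rule
    makes u differentiable ([differentiable_solve]), and differentiating A u = b
    eliminates the derivative of u ([derive_solve_form]):
    b^T u' = u^T A u' = u^T (b' - A' u), hence
    J' = - b'^T u - b^T u' = - 2 b'^T u + u^T A' u.
    The last formula follows because the i-th partial derivative of b has a single
    nonzero entry and that of A lives on the i-th row and column. *)

(** * Convergence of the Gamma integral *)

(** Both sides are measures in A, so it suffices to compare them on half-open
    intervals. *)
Lemma lebesgue_measure_scale (R : realType) (p : R) (A : set R) : 0 < p ->
  measurable A ->
  (lebesgue_measure A = p%:E * lebesgue_measure (( *%R p) @^-1` A))%E.
Proof.
move=> p_gt0 mA.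
pose ph : measurableTypeR R -> measurableTypeR R := *%R p.
have mph : measurable_fun [set: measurableTypeR R] ph.
  exact: mulrl_measurable.
(* the pushforward is a measure only given the measurability of ph, so that
   nu is a function of that proof *)
pose nu := mscale (NngNum (ltW p_gt0)) (pushforward lebesgue_measure ph).
rewrite (@lebesgue_measure_unique _ (nu mph)) //.
move=> X [[a b]] _ <-.
change (lebesgue_measure `]a, b]%classic
  = p%:E * lebesgue_measure (( *%R p) @^-1` `]a, b]%classic))%E.
have -> : ( *%R p) @^-1` `]a, b]%classic = `](p^-1 * a), (p^-1 * b)]%classic.
  by apply/seteqP; split=> x /=; rewrite !in_itv/= ler_pdivlMl ?ltr_pdivrMl.
rewrite !lebesgue_measure_itv/= !lte_fin ltr_pM2l ?invr_gt0//.
case: ifP => _; last by rewrite mule0.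
by rewrite -!EFinB -EFinM; congr EFin; field; rewrite gt_eqF.
Qed.

Lemma ge0_integral_scale (R : realType) (h : R -> \bar R) (p : R) : 0 < p ->
  measurable_fun setT h -> (forall t, (0 <= h t)%E) ->
  (\int[lebesgue_measure]_(t in `]0%R, +oo[) h t
   = p%:E * \int[lebesgue_measure]_(t in `]0%R, +oo[) h (p * t)%R)%E.
Proof.
move=> p_gt0 mh h0.
pose ph : measurableTypeR R -> measurableTypeR R := *%R p.
have mph : measurable_fun [set: measurableTypeR R] ph.
  exact: mulrl_measurable.
pose nu := mscale (NngNum (ltW p_gt0)) (pushforward lebesgue_measure ph).
rewrite (@eq_measure_integral _ _ _ _ (nu mph)); last first.
  by move=> A mA _; exact: (lebesgue_measure_scale p_gt0 mA).
have mh' : measurable_fun (`]0%R, +oo[ : set (measurableTypeR R)) h.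
  exact: measurable_funS mh.
rewrite ge0_integral_mscale//; congr (_ * _)%E.
rewrite (@ge0_integral_pushforward _ _ _ _ R ph)//.
have -> : ph @^-1` `]0, +oo[%classic = `]0, +oo[%classic.
  by apply/seteqP; split=> x /=; rewrite !in_itv/= !andbT pmulr_rgt0.
by [].
Qed.

(** From ln x < x at x = t / (2 s). *)
Lemma powR_le_expR (R : realType) (s t : R) : 0 < s -> 0 < t ->
  t `^ s <= (2 * s) `^ s * expR (t / 2).
Proof.
move=> s0 t0; have s20 : 0 < 2 * s by rewrite mulr_gt0.
have tE : t = 2 * s * (t / (2 * s)) by field; rewrite gt_eqF.
rewrite [in leLHS]tE powRM ?(ltW s20) ?(ltW (divr_gt0 t0 s20))//.
rewrite ler_wpM2l ?powR_ge0//.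
rewrite /powR gt_eqF ?divr_gt0// ler_expR.
have -> : t / 2 = s * (t / (2 * s)) by field; rewrite gt_eqF.
by rewrite ler_wpM2l ?ltW// ln_sublinear ?divr_gt0.
Qed.

Lemma measurable_powR_expR (R : realType) (s p : R) :
  measurable_fun [set: R] (fun t : R => t `^ s * expR (- (p * t))).
Proof.
apply: measurable_funM; first exact: measurable_powR.
apply: measurableT_comp => //; apply: measurableT_comp => //.
Qed.

(** The derivative of - 1 / (1 + t^s) behaves like s t^(s-1) near 0 and has an
    antiderivative bounded by 1 in absolute value; it serves as the dominating
    function for Euler's integrand, whose singularity at 0 when s < 1 rules out
    applying the fundamental theorem of calculus on the closed half-line. *)
Lemma is_derive_sigmoid (R : realType) (s t : R) : 0 < t ->
  is_derive t 1 (fun t : R => - (1 + t `^ s)^-1)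
    (s * t `^ (s - 1) / (1 + t `^ s) ^+ 2).
Proof.
move=> t0.
have p0 (x : R) : 1 + x `^ s != 0 by rewrite gt_eqF// ltr_pwDl ?powR_ge0.
have dp := is_derive1_powR s t0.
have d1 : is_derive t 1 (fun x : R => 1 + x `^ s) (s * t `^ (s - 1)).
  by have := is_deriveD (is_derive_cst (1 : R) t 1) dp; rewrite add0r.
have dV : is_derive t 1 (fun x : R => (1 + x `^ s)^-1)
    (- (1 + t `^ s) ^- 2 *: (s * t `^ (s - 1))).
  by split; [exact: derivableV|rewrite deriveV// derive_val].
apply: (@is_derive_eq _ _ _ _ _ _ _ _ (is_deriveN dV)).
by rewrite scaleNr opprK [LHS]mulrC.
Qed.

Lemma integral_sigmoid (R : realType) (s e : R) : 0 < s -> 0 < e ->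
  (\int[lebesgue_measure]_(t in `[e, +oo[)
     (s * t `^ (s - 1) / (1 + t `^ s) ^+ 2)%:E <= 1)%E.
Proof.
move=> s0 e0.
have p0 (x : R) : 0 < 1 + x `^ s by rewrite ltr_pwDl ?powR_ge0.
have dF (x : R) : e <= x -> is_derive x 1 (fun t : R => - (1 + t `^ s)^-1)
    (s * x `^ (s - 1) / (1 + x `^ s) ^+ 2).
  by move=> ex; apply: is_derive_sigmoid; exact: lt_le_trans ex.
have cpow (r x : R) : e <= x -> {for x, continuous (fun t : R => t `^ r)}.
  move=> ex; apply: differentiable_continuous; apply/derivable1_diffP.
  by apply: ex_derive; apply: is_derive1_powR; exact: lt_le_trans ex.
have cf (x : R) : e <= x ->
    {for x, continuous (fun t : R => s * t `^ (s - 1) / (1 + t `^ s) ^+ 2)}.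
  move=> ex; apply: cvgM.
    by apply: cvgM; [exact: cvg_cst|exact: cpow].
  apply: cvgV; first by rewrite expf_neq0// gt_eqF.
  by apply: cvgM; (apply: cvgD; [exact: cvg_cst|exact: cpow]).
rewrite (@ge0_continuous_FTC2y _ _ (fun t => - (1 + t `^ s)^-1) e 0).
- by rewrite -EFinB lee_fin sub0r opprK invf_le1// lerDl powR_ge0.
- by move=> x _; rewrite divr_ge0 ?mulr_ge0 ?powR_ge0 ?sqr_ge0// ltW.
- apply: continuous_in_subspaceT => x; rewrite inE/= in_itv/= andbT => ex.
  exact: cf.
- rewrite -oppr0; apply: cvgN; apply/cvgr0Pnorm_le => d d0; near=> x.
  have x0 : 0 <= x by near: x; apply: nbhs_pinfty_ge; exact: num_real.
  have xd : d^-1 `^ s^-1 <= x.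
    by near: x; apply: nbhs_pinfty_ge; exact: num_real.
  rewrite ger0_norm; last by rewrite invr_ge0 ltW.
  rewrite -[leRHS]invrK lef_pV2 ?posrE ?invr_gt0//.
  apply: (@le_trans _ _ (x `^ s)); last by rewrite lerDr.
  (* t^s exceeds 1/d as soon as t exceeds the s-th root of 1/d *)
  have -> : d^-1 = (d^-1 `^ s^-1) `^ s.
    by rewrite -powRrM mulVf ?gt_eqF// powRr1// invr_ge0 ltW.
  apply: ge0_ler_powR; rewrite ?nnegrE ?powR_ge0 ?(ltW s0)//.
- by move=> x /ltW ex; apply: ex_derive; exact: dF.
- apply: cvg_at_right_filter.
  suff : {for e, continuous (fun t : R => - (1 + t `^ s)^-1)} by [].
  apply: differentiable_continuous; apply/derivable1_diffP.
  by apply: ex_derive; exact: dF.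
- move=> x; rewrite in_itv/= andbT => /ltW ex.
  by rewrite derive1E; have [_ ->] := dF _ ex.
Unshelve. all: by end_near. Qed.

(** Since t^s <= (2 s)^s e^(t/2), the quantity (1 + t^s)^2 e^(-t) is bounded by
    (1 + (2 s)^s)^2, so a multiple of the derivative of - 1 / (1 + t^s) dominates
    the integrand.  That derivative has integral at most 1 over every [e, +oo[
    with 0 < e, hence over ]0, +oo[ by exhaustion. *)
Lemma integrable_gamma (R : realType) (s : R) : 0 < s ->
  lebesgue_measure.-integrable `]0, +oo[
    (EFin \o (fun t : R => t `^ (s - 1) * expR (- t))).
Proof.
move=> s0.
pose K : R := (1 + (2 * s) `^ s) ^+ 2 / s.
pose f (t : R) : R := s * t `^ (s - 1) / (1 + t `^ s) ^+ 2.
have mf : measurable_fun [set: R] f.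
  (* a real power is measurable, so write the inverse as one *)
  have -> : f = fun t => s * t `^ (s - 1) * (1 + t `^ s) `^ (- 2%:R).
    by apply/funext => t; rewrite powR_invn// addr_ge0 ?powR_ge0.
  apply: measurable_funM.
    by apply: measurable_funM => //; exact: measurable_powR.
  apply: (measurableT_comp (f := fun x : R => x `^ (- 2%:R))).
    exact: measurable_powR.
  apply: measurable_funD; first exact: measurable_cst.
  exact: measurable_powR.
have f0 (t : R) : 0 <= f t.
  by rewrite /f divr_ge0 ?mulr_ge0 ?addr_ge0 ?powR_ge0 ?(ltW s0).
have K0 : 0 <= K by rewrite /K divr_ge0 ?sqr_ge0 ?(ltW s0).
have intf : (\int[lebesgue_measure]_(t in `]0%R, +oo[) (f t)%:E <= 1)%E.
  (* exhaust ]0, +oo[ by the half-lines [1/(n+1), +oo[ *)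
  pose F n : set R := `[n.+1%:R^-1, +oo[%classic.
  have -> : `]0, +oo[%classic = \bigcup_n F n.
    apply/seteqP; split=> [x|x [n _]]; rewrite /= in_itv/= andbT.
      move=> x0; exists (Num.truncn x^-1) => //.
      rewrite /F/= in_itv/= andbT -[leRHS]invrK lef_pV2 ?posrE ?invr_gt0//.
      by apply/ltW; rewrite truncnS_gt.
    by rewrite /F/= in_itv/= andbT; apply: lt_le_trans; rewrite invr_gt0.
  have cv : (\int[lebesgue_measure]_(x in F i) (f x)%:E @[i --> \oo] -->
     \int[lebesgue_measure]_(x in \bigcup_i F i) (f x)%:E)%E.
    apply: ge0_nondecreasing_set_cvg_integral.
    - move=> m n mn; apply/subsetPset => x; rewrite /F/= !in_itv/= !andbT.
      by apply: le_trans; rewrite lef_pV2 ?posrE// ler_nat.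
    - by move=> n; exact: measurable_itv.
    - by move=> n; apply: measurable_funTS; exact/measurable_EFinP.
    - by move=> n x _; rewrite lee_fin.
  rewrite -(cvg_lim _ cv)//; apply: lime_le.
    by apply/cvg_ex; eexists; exact: cv.
  by apply: nearW => n; apply: integral_sigmoid.
have intK : lebesgue_measure.-integrable `]0, +oo[ (fun t : R => (K * f t)%:E).
  apply/integrableP; split.
    by apply: measurable_funTS; apply/measurable_EFinP; exact: measurable_funM.
  under eq_integral.
    move=> x _; rewrite gee0_abs; last first.
      by rewrite lee_fin mulr_ge0.
    rewrite EFinM; over.
  rewrite ge0_integralZl//.
  - by rewrite lte_mul_pinfty// ?(le_lt_trans intf) ?ltry// lee_fin.
  - by apply: measurable_funTS; apply/measurable_EFinP.
  - by move=> x _; rewrite lee_fin.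
apply: le_integrable intK => //.
  apply: measurable_funTS; apply/measurable_EFinP.
  by have := @measurable_powR_expR R (s - 1) 1; under eq_fun do rewrite mul1r.
move=> t /=; rewrite in_itv/= andbT => t0.
rewrite lee_fin (ger0_norm (mulr_ge0 K0 (f0 t))).
rewrite (ger0_norm (mulr_ge0 (powR_ge0 _ _) (expR_ge0 _))).
have p0 : 0 < 1 + t `^ s by rewrite ltr_pwDl ?powR_ge0.
have -> : K * f t =
    t `^ (s - 1) * ((1 + (2 * s) `^ s) ^+ 2 / (1 + t `^ s) ^+ 2).
  by rewrite /K /f; field; rewrite !gt_eqF.
rewrite ler_wpM2l ?powR_ge0// expRN -(invrK (_ / _)).
rewrite lef_pV2 ?posrE ?expR_gt0//; last first.
  by rewrite invr_gt0 divr_gt0 ?exprn_gt0// ltr_pwDl ?powR_ge0.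
rewrite invf_div ler_pdivrMr ?exprn_gt0 ?ltr_pwDl ?powR_ge0//.
have -> : expR t = expR (t / 2) ^+ 2 by rewrite expr2 -expRD; congr expR; field.
rewrite -exprMn ler_sqr ?nnegrE ?mulr_ge0 ?expR_ge0 ?(ltW p0)//; last first.
  by rewrite addr_ge0 ?powR_ge0.
rewrite mulrDr mulr1 lerD//; first by rewrite -expR0 ler_expR divr_ge0// ltW.
by rewrite mulrC powR_le_expR.
Qed.

(** * Laplace transforms of powers *)

Lemma laplace_powR (R : realType) (s p : R) : 0 < s -> 0 < p ->
  (\int[lebesgue_measure]_(t in `]0%R, +oo[)
     (t `^ (s - 1) * expR (- (p * t)))%:E
   = (Gamma s * p `^ (- s))%:E)%E.
Proof.
move=> s0 p0; have q0 : 0 < p^-1 by rewrite invr_gt0.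
rewrite (ge0_integral_scale q0); last 2 first.
  by apply/measurable_EFinP; exact: measurable_powR_expR.
  by move=> t; rewrite lee_fin mulr_ge0 ?powR_ge0 ?expR_ge0.
under eq_integral => t.
  rewrite inE/= in_itv/= andbT => t0.
  rewrite powRM ?(ltW q0) ?(ltW t0)// mulVKf ?gt_eqF// -mulrA EFinM; over.
have intg := integrable_gamma s0.
rewrite integralZl//.
rewrite -[X in (_ * (_ * X))%E]fineK; last exact: integrable_fin_num.
rewrite -!EFinM mulrA mulr_powRB1 ?(ltW q0)// mulrC.
by rewrite powRN -[in LHS]powR_inv1 ?(ltW p0)// -powRrM mulN1r powRN.
Qed.

Lemma integrable_laplace_powR (R : realType) (s p : R) : 0 < s -> 0 < p ->
  lebesgue_measure.-integrable `]0, +oo[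
    (EFin \o (fun t : R => t `^ (s - 1) * expR (- (p * t)))).
Proof.
move=> s0 p0; apply/integrableP; split.
  by apply: measurable_funTS; apply/measurable_EFinP;
    exact: measurable_powR_expR.
under eq_integral => t _.
  rewrite gee0_abs/= ?lee_fin ?mulr_ge0 ?powR_ge0 ?expR_ge0//; over.
by rewrite laplace_powR// ltry.
Qed.

(** The exponents s and p are only required to equal the sums, so that they can
    be supplied in simplified form. *)
Section weighted_product.
Variables (R : realType) (alpha delta r1 r2 p1 p2 s p : R).
Hypotheses (sE : s = r1 + r2 - alpha + 1) (pE : p = p1 + p2 + delta).

Let integrand (t : R) : R :=
  t `^ r1 * expR (- (p1 * t)) * (t `^ r2 * expR (- (p2 * t)))
  / weight alpha delta t.

Let integrandE : {in `]0, +oo[%classic, integrand =1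
  (fun t => t `^ (s - 1) * expR (- (p * t)))}.
Proof.
move=> t; rewrite inE/= in_itv/= andbT => t0; rewrite /integrand /weight sE pE.
have tn0 : t != 0 by rewrite gt_eqF.
have -> : expR (- ((p1 + p2 + delta) * t)) =
    expR (- (p1 * t)) * expR (- (p2 * t)) * expR (- (delta * t)).
  by rewrite -!expRD; congr expR; ring.
rewrite addrK !powRD ?tn0 ?implybT// powRN invfM -expRN.
set x := (_ `^ alpha)^-1; ring.
Qed.

Lemma inner_powR_expR : 0 < s -> 0 < p ->
  inner (weight alpha delta) (fun t => t `^ r1 * expR (- (p1 * t)))
    (fun t => t `^ r2 * expR (- (p2 * t))) = Gamma s * p `^ (- s).
Proof.
move=> s0 p0.
have -> : inner (weight alpha delta) (fun t => t `^ r1 * expR (- (p1 * t)))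
    (fun t => t `^ r2 * expR (- (p2 * t))) =
    \int[lebesgue_measure]_(t in `]0, +oo[) (t `^ (s - 1) * expR (- (p * t))).
  by apply: eq_Rintegral; exact: integrandE.
by rewrite /Rintegral laplace_powR.
Qed.

Lemma integrable_powR_expR : 0 < s -> 0 < p ->
  lebesgue_measure.-integrable `]0, +oo[ (EFin \o integrand).
Proof.
move=> s0 p0; apply: eq_integrable (integrable_laplace_powR s0 p0) => //.
by move=> t t0 /=; rewrite integrandE.
Qed.

End weighted_product.

(** * Gram matrices and independence of exponentials *)

(** Stated for an arbitrary finite family so that it covers both the quadratic
    form of A (the family of the e_j) and the objective (that family together
    with f). *)
Lemma integral_square_sum (R : realType) (m : nat) (w : R -> R)
    (v : 'I_m -> R -> R) (d : 'I_m -> R) :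
  (forall i j, lebesgue_measure.-integrable `]0, +oo[
     (EFin \o (fun t => v i t * v j t / w t))) ->
  lebesgue_measure.-integrable `]0, +oo[
    (EFin \o (fun t => (\sum_i d i * v i t) ^+ 2 / w t)) /\
  (\int[lebesgue_measure]_(t in `]0%R, +oo[)
     ((\sum_i d i * v i t)%R ^+ 2 / w t)%:E
   = (\sum_i \sum_j d i * d j * inner w (v i) (v j))%:E)%E.
Proof.
move=> vint.
have expand t : (\sum_i d i * v i t) ^+ 2 / w t =
    \sum_i \sum_j d i * d j * (v i t * v j t / w t).
  rewrite expr2 mulr_suml mulr_suml; apply: eq_bigr => i _.
  rewrite mulr_sumr mulr_suml; apply: eq_bigr => j _.
  by rewrite mulrACA !mulrA.
have dint i j : lebesgue_measure.-integrable `]0, +oo[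
    (fun t => (d i * d j)%:E * (v i t * v j t / w t)%:E)%E.
  have := vint i j; apply: integrableZl => //.
have sint i : lebesgue_measure.-integrable `]0, +oo[
    (fun t => \sum_j (d i * d j)%:E * (v i t * v j t / w t)%:E)%E.
  exact: integrable_sum.
have expandE t : (\sum_i \sum_j (d i * d j)%:E * (v i t * v j t / w t)%:E)%E =
    ((\sum_i d i * v i t) ^+ 2 / w t)%:E.
  rewrite expand -sumEFin; apply: eq_bigr => i _.
  by rewrite -sumEFin; apply: eq_bigr => j _; rewrite EFinM.
split.
  have sint2 : lebesgue_measure.-integrable `]0, +oo[
      (fun t => \sum_i \sum_j (d i * d j)%:E * (v i t * v j t / w t)%:E)%E.
    exact: integrable_sum.
  by apply: eq_integrable sint2 => // t _; rewrite expandE.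
under eq_integral do rewrite -expandE.
rewrite integral_sum// -sumEFin; apply: eq_bigr => i _.
rewrite integral_sum// -sumEFin; apply: eq_bigr => j _.
have vij := vint i j.
rewrite integralZl//; apply/esym; rewrite EFinM; congr (_ * _)%E.
by rewrite fineK//; exact: integrable_fin_num.
Qed.

(** If h does not vanish at t, it does not vanish on a ball around t, and a ball
    has positive measure. *)
Lemma ae_eq0_continuous (R : realType) (h : R -> R) : continuous h ->
  ae_eq lebesgue_measure `]0, +oo[%classic (EFin \o h) (cst 0%E) ->
  forall t, 0 < t -> h t = 0.
Proof.
move=> ch hae t t0; apply/eqP; apply/negPn/negP => ht0.
have /nbhs_ballP[e /= e0 eh] : \forall x \near t, h x != 0 /\ 0 < x.
  apply: filterI; last exact: lt_nbhsr.
  have := ch t; move=> /cvgrPdist_lt/(_ `|h t|).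
  rewrite normr_gt0 => /(_ ht0); apply: filterS => x.
  apply: contraTneq => ->; by rewrite subr0 ltxx.
have [N [mN N0 hN]] := hae.
have : (lebesgue_measure (ball t e) <= lebesgue_measure N)%E.
  apply: le_measure; rewrite ?inE//; first exact: measurable_ball.
  move=> x /eh[hx x0]; apply: hN => /=.
  rewrite in_itv/= x0 => /(_ isT) [] h0.
  by rewrite h0 eqxx in hx.
rewrite N0 lebesgue_measure_ball ?(ltW e0)// lee_fin leNgt.
by rewrite mulrn_wgt0.
Qed.

(** With x_k = e^(- l_k), the values at the times t = m + 1 say that
    sum_k v_k x_k q(x_k) = 0 for every polynomial q.  Choosing for q the product
    of the X - x_k over k <> j isolates v_j. *)
Lemma expR_free (R : realType) (n : nat) (l v : 'I_n -> R) :
  injective l ->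
  (forall t, 0 < t -> \sum_j v j * expR (- (l j * t)) = 0) ->
  forall j, v j = 0.
Proof.
move=> linj v0 j.
pose x k := expR (- l k).
have xpow k m : expR (- (l k * m.+1%:R)) = x k * x k ^+ m.
  by rewrite -exprS -expRM_natl mulrC mulrN.
have polyE (q : {poly R}) : \sum_k v k * x k * q.[x k] = 0.
  under eq_bigr do rewrite horner_coef mulr_sumr.
  rewrite exchange_big big1//= => m _.
  transitivity (q`_m * \sum_k v k * expR (- (l k * m.+1%:R))).
    by rewrite mulr_sumr; apply: eq_bigr => k _; rewrite xpow; ring.
  by rewrite v0 ?mulr0// ltr0n.
(* Lagrange interpolation polynomial at the x_k, up to a factor *)
pose q := \prod_(k < n | k != j) ('X - (x k)%:P).
have qx k : k != j -> q.[x k] = 0.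
  by move=> kj; rewrite horner_prod (bigD1 k)//= hornerXsubC subrr mul0r.
have := polyE q.
rewrite (bigD1 j)//= big1 => [|k kj]; last by rewrite qx ?mulr0.
rewrite addr0 horner_prod => /eqP; rewrite !mulf_eq0 -orbA => /or3P[/eqP//| |].
  by rewrite gt_eqF ?expR_gt0.
rewrite prodf_seq_eq0 => /hasP[k _ /andP[kj]].
rewrite hornerXsubC subr_eq0 => /eqP/expR_inj/oppr_inj/linj jk.
by rewrite jk eqxx in kj.
Qed.

(** * The least-squares problem *)

Lemma mxquadE (R : comRingType) (n : nat) (A : 'M[R]_n) (c : 'cV[R]_n) :
  (c^T *m A *m c) 0 0 = \sum_i \sum_j c i 0 * c j 0 * A i j.
Proof.
rewrite mxE exchange_big/=; apply: eq_bigr => j _.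
rewrite !mxE mulr_suml; apply: eq_bigr => i _.
by rewrite mxE mulrAC.
Qed.

Lemma complete_square (R : comUnitRingType) (n : nat) (A : 'M[R]_n)
    (b c : 'cV[R]_n) : A^T = A -> A \in unitmx ->
  let u := invmx A *m b in
  (c^T *m A *m c) 0 0 - 2 * (b^T *m c) 0 0 =
  ((c - u)^T *m A *m (c - u)) 0 0 - (b^T *m invmx A *m b) 0 0.
Proof.
move=> symA uA u.
have uTA : u^T *m A = b^T.
  by rewrite -[in LHS]symA -trmx_mul /u mulmxA mulmxV// mul1mx.
have bu : b^T *m invmx A *m b = b^T *m u by rewrite /u mulmxA.
have cAu : (c^T *m A *m u) 0 0 = (b^T *m c) 0 0.
  by rewrite /u !mulmxA mulmxK// -[in RHS](trmxK c) -trmx_mul [RHS]mxE.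
have subE (X Y : 'M[R]_1) : (X - Y) 0 0 = X 0 0 - Y 0 0 by rewrite !mxE.
have -> : (c - u)^T = c^T - u^T by apply/matrixP => i j; rewrite !mxE.
rewrite bu mulmxBl mulmxBl uTA !mulmxBr !subE cAu; ring.
Qed.

Lemma innerC (R : realType) (w u v : R -> R) : inner w u v = inner w v u.
Proof. by apply: eq_Rintegral => t _; rewrite [X in X / _]mulrC. Qed.

Section gram.
Variables (R : realType) (n : nat) (alpha beta delta kappa : R).
Hypotheses (delta_gt : - (2 * kappa ^+ 2) < delta) (alpha_lt1 : alpha < 1).
Hypotheses (alpha_lt_beta : alpha < beta) (alpha_lt_2beta1 : alpha < 2 * beta - 1).
Implicit Type g : 'rV[R]_n.

Let f_targetE : f_target beta kappa =
  (fun t => t `^ (beta - 1) * expR (- (kappa ^+ 2 * t))).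
Proof. by []. Qed.

Let e_funE g j : e_fun kappa g j =
  (fun t => t `^ 0 * expR (- ((kappa ^+ 2 + g 0 j) * t))).
Proof. by apply/funext => t; rewrite powRr0 mul1r. Qed.

Lemma a_coefE : a_coef alpha beta delta kappa =
  Gamma (2 * beta - 1 - alpha)
  * (2 * kappa ^+ 2 + delta) `^ (- (2 * beta - 1 - alpha)).
Proof.
rewrite /a_coef f_targetE; apply: inner_powR_expR.
- by ring.
- by ring.
- move: alpha_lt_2beta1; lra.
- move: delta_gt; lra.
Qed.

Lemma b_vecE g j : 0 < g 0 j -> b_vec alpha beta delta kappa g j 0 =
  Gamma (beta - alpha)
  * (2 * kappa ^+ 2 + g 0 j + delta) `^ (- (beta - alpha)).
Proof.
move=> gj0; rewrite mxE f_targetE e_funE; apply: inner_powR_expR.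
- by ring.
- by ring.
- move: alpha_lt_beta; lra.
- move: delta_gt; lra.
Qed.

Lemma A_mxE g j k : 0 < g 0 j -> 0 < g 0 k -> A_mx alpha delta kappa g j k =
  Gamma (1 - alpha)
  * (2 * kappa ^+ 2 + g 0 j + g 0 k + delta) `^ (- (1 - alpha)).
Proof.
move=> gj0 gk0; rewrite mxE !e_funE; apply: inner_powR_expR.
- by ring.
- by ring.
- move: alpha_lt1; lra.
- move: delta_gt; lra.
Qed.

Lemma A_mx_sym g : (A_mx alpha delta kappa g)^T = A_mx alpha delta kappa g.
Proof.
by apply/matrixP => j k; rewrite !mxE innerC.
Qed.

Lemma integrable_e_fun g j k : 0 < g 0 j -> 0 < g 0 k ->
  lebesgue_measure.-integrable `]0, +oo[
    (EFin \o (fun t => e_fun kappa g j t * e_fun kappa g k t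
                       / weight alpha delta t)).
Proof.
move=> gj0 gk0; rewrite !e_funE; apply: integrable_powR_expR => //.
  by move: alpha_lt1; lra.
move: delta_gt; lra.
Qed.

(** The integrand is the square of a combination of the n + 1 functions f, e_j
    with coefficients 1, - c_j, over w. *)
Lemma objectiveE g (c : 'cV[R]_n) : (forall j, 0 < g 0 j) ->
  let A := A_mx alpha delta kappa g in
  let b := b_vec alpha beta delta kappa g in
  objective alpha beta delta kappa g c =
  (a_coef alpha beta delta kappa
   + ((c^T *m A *m c) 0 0 - 2 * (b^T *m c) 0 0))%:E.
Proof.
move=> g0 A b.
pose v i := if unlift ord0 i is Some j then e_fun kappa g j
            else f_target beta kappa.
pose d i : R := if unlift ord0 i is Some j then - c j 0 else 1.
have v0 : v ord0 = f_target beta kappa by rewrite /v unlift_none.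
have vS j : v (lift ord0 j) = e_fun kappa g j by rewrite /v liftK.
have d0 : d ord0 = 1 by rewrite /d unlift_none.
have dS j : d (lift ord0 j) = - c j 0 by rewrite /d liftK.
have vint i j : lebesgue_measure.-integrable `]0, +oo[
    (EFin \o (fun t => v i t * v j t / weight alpha delta t)).
  rewrite /v; case: unliftP => [i' _|_]; case: unliftP => [j' _|_];
    rewrite ?e_funE ?f_targetE; apply: integrable_powR_expR => //;
    move: delta_gt alpha_lt1 alpha_lt_beta alpha_lt_2beta1;
    try (have := g0 i'); try (have := g0 j'); lra.
have [_ sqE] := integral_square_sum d vint.
transitivity (\int[lebesgue_measure]_(t in `]0%R, +oo[)
     ((\sum_i d i * v i t)%R ^+ 2 / weight alpha delta t)%:E)%E.
  apply: eq_integral => t _; rewrite real_normK ?num_real//.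
  rewrite big_ord_recl d0 v0 mul1r; congr (((_ + _) ^+ 2 / _)%:E).
  by rewrite -sumrN; apply: eq_bigr => j _; rewrite dS vS mulNr.
rewrite sqE; congr EFin.
have bcE : (b^T *m c) 0 0 = \sum_j c j 0 * b j 0.
  by rewrite mxE; apply: eq_bigr => j _; rewrite mxE mulrC.
rewrite big_ord_recl big_ord_recl d0 v0 !mul1r -addrA; congr (_ + _).
have -> (x y : R) : x - 2 * y = - y + (- y + x) by ring.
rewrite bcE mxquadE -sumrN; congr (_ + _).
  by apply: eq_bigr => j _; rewrite dS vS [b j 0]mxE mul1r mulNr.
rewrite -big_split; apply: eq_bigr => i _ /=.
rewrite big_ord_recl d0 v0 dS vS mulr1 innerC [b i 0]mxE mulNr; congr (_ + _).
by apply: eq_bigr => j _; rewrite dS vS mulrNN [A i j]mxE.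
Qed.

(** If c^T A c = 0, then sum_j c_j e_j vanishes almost everywhere, hence
    everywhere by continuity. *)
Lemma A_mx_posdef g : (forall j, 0 < g 0 j) ->
  (forall j k, j != k -> g 0 j != g 0 k) ->
  let A := A_mx alpha delta kappa g in
  forall c : 'cV[R]_n, 0 <= (c^T *m A *m c) 0 0 /\
    ((c^T *m A *m c) 0 0 = 0 -> c = 0).
Proof.
move=> g0 ginj A c.
have [hint sqE] := integral_square_sum (fun j => c j 0)
  (fun i j => integrable_e_fun (g0 i) (g0 j)).
set h := (X in EFin \o X) in hint.
have h0 t : 0 <= h t.
  by rewrite /h divr_ge0 ?sqr_ge0// mulr_ge0 ?powR_ge0 ?expR_ge0.
have quadE : (\int[lebesgue_measure]_(t in `]0%R, +oo[) (h t)%:E)%E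
    = ((c^T *m A *m c) 0 0)%:E.
  rewrite sqE mxquadE; congr EFin.
  by apply: eq_bigr => i _; apply: eq_bigr => j _; rewrite [A i j]mxE.
split; first by rewrite -lee_fin -quadE integral_ge0// => t _; rewrite lee_fin.
move=> q0; move: quadE; rewrite q0 => int0.
have hae : ae_eq lebesgue_measure `]0, +oo[%classic (EFin \o h) (cst 0%E).
  apply/ae_eq_integral_abs => //; first exact: measurable_int hint.
  by rewrite -[RHS]int0; apply: eq_integral => t _; rewrite gee0_abs ?lee_fin.
pose k (t : R) : R := \sum_j c j 0 * expR (- ((kappa ^+ 2 + g 0 j) * t)).
have kae : ae_eq lebesgue_measure `]0, +oo[%classic (EFin \o k) (cst 0%E).
  apply: filterS hae => t ht tpos; move: (ht tpos) => [] /eqP.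
  move: tpos; rewrite /= in_itv/= andbT => tpos.
  rewrite /h mulf_eq0 sqrf_eq0 invr_eq0 => /orP[/eqP kt|].
    by congr EFin.
  by rewrite gt_eqF// mulr_gt0 ?powR_gt0 ?expR_gt0.
have kcont : continuous k.
  apply: continuous_big => [|j _ t]; first exact: add_continuous.
  apply: cvgM; first exact: cvg_cst.
  apply: continuous_comp; last exact: continuous_expR.
  by apply: cvgN; apply: cvgM; [exact: cvg_cst|exact: cvg_id].
have k0 := ae_eq0_continuous kcont kae.
have linj : injective (fun j => kappa ^+ 2 + g 0 j).
  move=> i j /addrI gij; apply/eqP/negPn/negP => /ginj.
  by rewrite gij eqxx.
apply/matrixP => j z; rewrite ord1 [RHS]mxE.
exact: (expR_free linj k0).
Qed.

Lemma A_mx_unit g : (forall j, 0 < g 0 j) ->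
  (forall j k, j != k -> g 0 j != g 0 k) ->
  A_mx alpha delta kappa g \in unitmx.
Proof.
move=> g0 ginj; rewrite unitmxE unitfE; apply/negP => /det0P[v v0 vA].
have [_ vT0] := A_mx_posdef g0 ginj v^T.
case/eqP: v0; rewrite -[v]trmxK vT0 ?trmx0//.
by rewrite trmxK vA mul0mx mxE.
Qed.

(** The objective at c exceeds a - b^T A^-1 b by (c - u)^T A (c - u). *)
Lemma objective_min g : (forall j, 0 < g 0 j) ->
  (forall j k, j != k -> g 0 j != g 0 k) ->
  let A := A_mx alpha delta kappa g in
  let b := b_vec alpha beta delta kappa g in
  objective alpha beta delta kappa g (u_vec alpha beta delta kappa g) =
    (J_hat alpha beta delta kappa g)%:E /\
  J_hat alpha beta delta kappa g =
    a_coef alpha beta delta kappa - (b^T *m invmx A *m b) 0 0.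
Proof.
move=> g0 ginj A b.
pose m := a_coef alpha beta delta kappa - (b^T *m invmx A *m b) 0 0.
pose u := u_vec alpha beta delta kappa g.
have objE c : objective alpha beta delta kappa g c =
    (m + ((c - u)^T *m A *m (c - u)) 0 0)%:E.
  rewrite objectiveE// complete_square ?A_mx_sym ?A_mx_unit//.
  by congr EFin; rewrite /m -/A -/b -/u addrA addrAC.
have objm : objective alpha beta delta kappa g u = m%:E.
  by rewrite objE subrr mulmx0 mxE addr0.
have infE : ereal_inf (range (objective alpha beta delta kappa g)) = m%:E.
  apply/eqP; rewrite eq_le; apply/andP; split.
    by rewrite -objm; apply: ereal_inf_lbound; exists u.
  apply: le_ereal_inf_tmp => _ [c _ <-]; rewrite objE lee_fin lerDl.
  by have [] := A_mx_posdef g0 ginj (c - u).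
by rewrite /J_hat infE.
Qed.
End gram.

(** * Differentiating the value of a linear system *)

(** The expansion of f at x, with the same linear part, is also one of g. *)
Lemma near_eq_differentiable (R : realType) (V W : normedModType R)
    (f g : V -> W) (x : V) :
  (\forall y \near x, f y = g y) -> differentiable f x -> differentiable g x.
Proof.
move=> fg /diff_locallyP[dfc fE].
have gE : g \o shift x = cst (g x) + 'd f x +o_ 0 id.
  apply/eqaddoP => e e0; move/eqaddoP: fE => /(_ e e0).
  have : \forall h \near (0 : V), f (h + x) = g (h + x).
    by move: fg; rewrite (near_shift 0 x); apply: filterS => h /=; rewrite subr0.
  apply: filterS2 => h fgh; rewrite /= /cst /=.
  by rewrite -(nbhs_singleton fg) fctE /= fgh.
have dgE : 'd g x = 'd f x :> (V -> W) by exact: diff_unique.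
by apply/diff_locallyP; rewrite dgE.
Qed.

Section big_differentiable.
Variables (R : realType) (V : normedModType R) (x : V).
Variables (I : Type) (r : seq I) (P : pred I) (F : I -> V -> R).
Hypothesis dF : forall i, differentiable (F i) x.

Lemma differentiable_bigsum :
  differentiable (fun y => \sum_(i <- r | P i) F i y) x.
Proof.
elim: r => [|i s IH].
  under eq_fun do rewrite big_nil; exact: differentiable_cst.
under eq_fun do rewrite big_cons.
by case: (P i) => //; exact: (differentiableD (dF i) IH).
Qed.

Lemma differentiable_bigprod :
  differentiable (fun y => \prod_(i <- r | P i) F i y) x.
Proof.
elim: r => [|i s IH].
  under eq_fun do rewrite big_nil; exact: differentiable_cst.
under eq_fun do rewrite big_cons.
by case: (P i) => //; exact: (differentiableM (dF i) IH).
Qed.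
End big_differentiable.

Lemma differentiable_det (R : realType) (V : normedModType R) (x : V) (n : nat)
    (M : V -> 'M[R]_n) : (forall i j, differentiable (fun y => M y i j) x) ->
  differentiable (fun y => \det (M y)) x.
Proof.
move=> dM; apply: differentiable_bigsum => s; apply: differentiableM => //.
by apply: differentiable_bigprod => i.
Qed.

(** Cramer's rule: near x the inverse is the adjugate divided by the determinant,
    and both are polynomials in the entries. *)
Lemma differentiable_solve (R : realType) (V : normedModType R) (x : V) (n : nat)
    (A : V -> 'M[R]_n) (b : V -> 'cV[R]_n) :
  (\forall y \near x, A y \in unitmx) ->
  (forall i j, differentiable (fun y => A y i j) x) ->
  (forall j, differentiable (fun y => b y j 0) x) ->
  forall j, differentiable (fun y => (invmx (A y) *m b y) j 0) x.
Proof.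
move=> uA dA db j.
have ux := nbhs_singleton uA.
apply: (near_eq_differentiable (f := fun y =>
  \sum_k (\det (A y))^-1 * cofactor (A y) k j * b y k 0)).
  apply: filterS uA => y uAy; rewrite mxE; apply: eq_bigr => k _.
  by rewrite /invmx uAy !mxE.
apply: differentiable_bigsum => k; apply: differentiableM => //.
apply: differentiableM.
  apply: differentiableV; first exact: differentiable_det.
  by move: ux; rewrite unitmxE unitfE.
apply: differentiableM => //; apply: differentiable_det => i' j'.
by under eq_fun do rewrite !mxE.
Qed.

Lemma derive_dot (R : realType) (V : normedModType R) (x v : V) (n : nat)
    (f g : 'I_n -> V -> R) :
  (forall k, differentiable (f k) x) -> (forall k, differentiable (g k) x) ->
  'D_v (fun y => \sum_k f k y * g k y) x =
  \sum_k ('D_v (f k) x * g k x + f k x * 'D_v (g k) x).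
Proof.
move=> df dg.
have -> : (fun y => \sum_k f k y * g k y) = \sum_(k < n) (f k * g k).
  by apply/funext => y; rewrite fct_sumE.
rewrite derive_sum => [|k]; last first.
  by apply: derivableM; exact: diff_derivable.
apply: eq_bigr => k _.
rewrite deriveM; try exact: diff_derivable.
by rewrite addrC [g k x *: _]mulrC.
Qed.

(** The derivative of the solution w of A w = b does not appear in the result:
    b^T w' = (A w)^T w' = w^T A w' by symmetry, and A w' = b' - A' w. *)
Lemma derive_solve_form (R : realType) (V : normedModType R) (x v : V) (n : nat)
    (A : V -> 'M[R]_n) (b : V -> 'cV[R]_n) :
  (\forall y \near x, A y \in unitmx) -> (A x)^T = A x ->
  (forall i j, differentiable (fun y => A y i j) x) ->
  (forall j, differentiable (fun y => b y j 0) x) ->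
  let u := invmx (A x) *m b x in
  differentiable (fun y => ((b y)^T *m invmx (A y) *m b y) 0 0) x /\
  'D_v (fun y => ((b y)^T *m invmx (A y) *m b y) 0 0) x =
  2 * (('D_v b x)^T *m u) 0 0 - (u^T *m 'D_v A x *m u) 0 0.
Proof.
move=> uA symA dA db u.
pose w j y := (invmx (A y) *m b y) j 0.
have dw j : differentiable (w j) x by exact: differentiable_solve.
have formE : (fun y => ((b y)^T *m invmx (A y) *m b y) 0 0) =
    (fun y => \sum_j b y j 0 * w j y).
  apply/funext => y; rewrite -mulmxA mxE.
  by apply: eq_bigr => j _; rewrite mxE.
rewrite formE; split.
  by apply: differentiable_bigsum => j; exact: differentiableM.
have dbE j : ('D_v b x) j 0 = 'D_v (fun y => b y j 0) x.
  rewrite derive_mx ?mxE//; apply/derivable_mxP => i k.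
  by rewrite ord1; exact: diff_derivable.
have dAE i j : ('D_v A x) i j = 'D_v (fun y => A y i j) x.
  rewrite derive_mx ?mxE//; apply/derivable_mxP => i' j'.
  exact: diff_derivable.
have solve y j : A y \in unitmx -> \sum_k A y j k * w k y = b y j 0.
  by move=> uAy; rewrite -[in RHS](mulKVmx uAy (b y)) mxE.
have dsolve j : ('D_v b x) j 0 =
    \sum_k (('D_v A x) j k * w k x + A x j k * 'D_v (w k) x).
  under eq_bigr do rewrite dAE.
  rewrite dbE -(derive_dot v (f := fun k y => A y j k))//.
  by apply: near_eq_derive; apply: filterS uA => y /solve ->.
(* expand b as A w and use the symmetry of A *)
have swap : \sum_j b x j 0 * 'D_v (w j) x =
    \sum_k w k x * \sum_j A x k j * 'D_v (w j) x.
  under eq_bigr => j _ do rewrite -(solve x j (nbhs_singleton uA)) mulr_suml.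
  rewrite exchange_big/=; apply: eq_bigr => k _.
  rewrite mulr_sumr; apply: eq_bigr => j _.
  by rewrite -{1}symA mxE mulrAC mulrC.
rewrite (derive_dot v (f := fun j y => b y j 0))// big_split/= swap.
(* substitute A w' = b' - A' w row by row *)
have -> : \sum_k w k x * (\sum_j A x k j * 'D_v (w j) x) =
   \sum_k w k x * ('D_v b x) k 0 - (u^T *m 'D_v A x *m u) 0 0.
  rewrite mxquadE -sumrB; apply: eq_bigr => k _.
  rewrite dsolve big_split/= mulrDr addrAC [X in _ = X + _](_ : _ = 0) ?add0r//.
  apply/eqP; rewrite subr_eq0 mulr_sumr; apply/eqP; apply: eq_bigr => j _.
  by rewrite -/(w k x) -/(w j x); ring.
rewrite addrA; congr (_ - _).
have -> : (('D_v b x)^T *m u) 0 0 = \sum_j w j x * ('D_v b x) j 0.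
  by rewrite mxE; apply: eq_bigr => j _; rewrite mxE mulrC.
rewrite mulr_natl mulr2n; congr (_ + _).
by apply: eq_bigr => j _; rewrite dbE mulrC.
Qed.

(** * The gradient of the reduced objective *)

(** The coordinates of the derivative of the identity. *)
Lemma derive_coord (R : realType) (m n : nat) (M v : 'M[R]_(m, n)) i j :
  'D_v (fun N : 'M[R]_(m, n) => N i j) M = v i j.
Proof.
have dId : derivable id M v by exact: derivable_id.
by have := derive_mx dId; rewrite derive_id => {2}->; rewrite mxE.
Qed.

Lemma derive_powR_comp (R : realType) (V : normedModType R) (L : V -> R)
    (c r : R) (x v : V) : differentiable L x -> 0 < L x ->
  differentiable (fun y => c * L y `^ r) x /\
  'D_v (fun y => c * L y `^ r) x = c * (r * L x `^ (r - 1)) * 'D_v L x.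
Proof.
move=> dL Lx0.
have dp := is_derive1_powR r Lx0.
have dpow : differentiable (fun t : R => t `^ r) (L x).
  by apply/derivable1_diffP; exact: ex_derive.
have dpL : differentiable (fun y => L y `^ r) x.
  exact: (differentiable_comp dL dpow).
split; first by apply: differentiableM.
rewrite -[fun y => _]/(c \*: (fun y => L y `^ r)) deriveZ; last first.
  exact: diff_derivable.
rewrite -mulrA; congr (_ * _).
rewrite !deriveE// (diff_comp dL dpow)/= deriv1E; last exact: ex_derive.
by rewrite derive1E derive_val [LHS]mulrC.
Qed.

Section gradient.
Variables (R : realType) (n : nat) (alpha beta delta kappa : R).
Hypotheses (delta_gt : - (2 * kappa ^+ 2) < delta) (alpha_lt1 : alpha < 1).
Hypothesis alpha_lt_beta : alpha < beta.
Variable g : 'rV[R]_n.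
Hypothesis g_gt0 : forall j, 0 < g 0 j.

Lemma near_gt0 : {near g, forall h : 'rV[R]_n, forall j, 0 < h 0 j}.
Proof.
apply: (@filter_forall _ _ (fun j (h : 'rV[R]_n) => 0 < h 0 j)
  _ (nbhs_filter g)) => j.
exact: (cvgr_gt _ (@coord_continuous _ _ _ 0 j g)).
Qed.

Lemma near_distinct : (forall j k, j != k -> g 0 j != g 0 k) ->
  {near g, forall h : 'rV[R]_n, forall j k, j != k -> h 0 j != h 0 k}.
Proof.
move=> ginj; apply: (@filter_forall _ _
  (fun j (h : 'rV[R]_n) => forall k, j != k -> h 0 j != h 0 k)
  _ (nbhs_filter g)) => j.
apply: (@filter_forall _ _
  (fun k (h : 'rV[R]_n) => j != k -> h 0 j != h 0 k) _ (nbhs_filter g)) => k.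
have [->|jk] := eqVneq j k; first by apply: nearW.
have jk0 : g 0 j - g 0 k != 0 by rewrite subr_eq0 ginj.
have cjk : (fun h : 'rV[R]_n => h 0 j - h 0 k) @ g --> (g 0 j - g 0 k).
  exact: (cvgB (@coord_continuous _ _ _ 0 j g) (@coord_continuous _ _ _ 0 k g)).
have := cvgr_neq0 _ cjk jk0 => /(_ (nbhs_filter g)).
by apply: (@filterS _ _ (nbhs_filter g)) => h; rewrite subr_eq0.
Qed.

Lemma b_vec_derive j i :
  differentiable (fun h : 'rV[R]_n => b_vec alpha beta delta kappa h j 0) g /\
  'D_(dir R i) (fun h : 'rV[R]_n => b_vec alpha beta delta kappa h j 0) g =
  - ((beta - alpha) * Gamma (beta - alpha)
     * (2 * kappa ^+ 2 + g 0 j + delta) `^ (- (beta - alpha + 1)))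
  * (j == i)%:R.
Proof.
pose L (h : 'rV[R]_n) := 2 * kappa ^+ 2 + h 0 j + delta.
have nearE : \forall h \near g, Gamma (beta - alpha) * L h `^ (- (beta - alpha))
    = b_vec alpha beta delta kappa h j 0.
  by apply: (@filterS _ _ (nbhs_filter g) _ _ _ near_gt0) => h h0;
    rewrite b_vecE.
have dL : differentiable L g.
  apply: differentiableD => //; apply: differentiableD => //.
  exact: differentiable_coord.
have DL : 'D_(dir R i) L g = (j == i)%:R.
  have dc := derivableP (diff_derivable (v := dir R i)
    (differentiable_coord g 0 j)).
  have [_ DE] := is_deriveD (is_deriveD
    (is_derive_cst (2 * kappa ^+ 2) g (dir R i)) dc)
    (is_derive_cst delta g (dir R i)).
  apply: (eq_trans DE).
  by rewrite derive_coord mxE eqxx add0r addr0.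
have L0 : 0 < L g by rewrite /L; have := g_gt0 j; move: delta_gt; lra.
have [dpow Dpow] := derive_powR_comp (Gamma (beta - alpha))
  (- (beta - alpha)) (dir R i) dL L0.
split; first exact: near_eq_differentiable nearE dpow.
rewrite -(near_eq_derive _ nearE) Dpow DL -opprD.
by congr (_ * _); rewrite /L; ring.
Qed.

Lemma A_mx_derive j k i :
  differentiable (fun h : 'rV[R]_n => A_mx alpha delta kappa h j k) g /\
  'D_(dir R i) (fun h : 'rV[R]_n => A_mx alpha delta kappa h j k) g =
  - ((1 - alpha) * Gamma (1 - alpha)
     * (2 * kappa ^+ 2 + g 0 j + g 0 k + delta) `^ (- (2 - alpha)))
  * ((j == i)%:R + (k == i)%:R).
Proof.
pose L (h : 'rV[R]_n) := 2 * kappa ^+ 2 + h 0 j + h 0 k + delta.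
have nearE : \forall h \near g, Gamma (1 - alpha) * L h `^ (- (1 - alpha))
    = A_mx alpha delta kappa h j k.
  by apply: (@filterS _ _ (nbhs_filter g) _ _ _ near_gt0) => h h0;
    rewrite A_mxE.
have dc l : differentiable (fun h : 'rV[R]_n => h 0 l) g.
  exact: differentiable_coord.
have dL : differentiable L g by do 3 (apply: differentiableD => //).
have DL : 'D_(dir R i) L g = (j == i)%:R + (k == i)%:R.
  have dc' l := derivableP (diff_derivable (v := dir R i) (dc l)).
  have [_ DE] := is_deriveD (is_deriveD (is_deriveD
    (is_derive_cst (2 * kappa ^+ 2) g (dir R i)) (dc' j)) (dc' k))
    (is_derive_cst delta g (dir R i)).
  apply: (eq_trans DE).
  by rewrite !derive_coord !mxE eqxx add0r addr0.
have L0 : 0 < L g.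
  by rewrite /L; have := g_gt0 j; have := g_gt0 k; move: delta_gt; lra.
have [dpow Dpow] := derive_powR_comp (Gamma (1 - alpha))
  (- (1 - alpha)) (dir R i) dL L0.
split; first exact: near_eq_differentiable nearE dpow.
rewrite -(near_eq_derive _ nearE) Dpow DL.
have -> : - (1 - alpha) - 1 = - (2 - alpha) by ring.
by congr (_ * _); rewrite /L; ring.
Qed.

Lemma derivable_b_vec i :
  derivable (@b_vec R alpha beta delta kappa n) g (dir R i).
Proof.
apply/derivable_mxP => j z; rewrite ord1; apply: diff_derivable.
by have [] := b_vec_derive j i.
Qed.

Lemma derivable_A_mx i :
  derivable (@A_mx R alpha delta kappa n) g (dir R i).
Proof.
apply/derivable_mxP => j k; apply: diff_derivable.
by have [] := A_mx_derive j k i.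
Qed.

Lemma derive_b_vec_form i (u : 'cV[R]_n) :
  (('D_(dir R i) (@b_vec R alpha beta delta kappa n) g)^T *m u) 0 0 =
  - ((beta - alpha) * Gamma (beta - alpha)
     * (2 * kappa ^+ 2 + g 0 i + delta) `^ (- (beta - alpha + 1)) * u i 0).
Proof.
rewrite mxE (bigD1 i)//= big1 => [|j ji].
  rewrite addr0 mxE derive_mx; last exact: derivable_b_vec.
  by rewrite mxE (b_vec_derive i i).2 eqxx mulr1 mulNr.
rewrite mxE derive_mx; last exact: derivable_b_vec.
by rewrite mxE (b_vec_derive j i).2 (negbTE ji) mulr0 mul0r.
Qed.

Lemma derive_A_mx_form i (u : 'cV[R]_n) :
  (u^T *m 'D_(dir R i) (@A_mx R alpha delta kappa n) g *m u) 0 0 =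
  - (2 * (1 - alpha) * Gamma (1 - alpha) * u i 0
     * \sum_k u k 0 * (2 * kappa ^+ 2 + g 0 i + g 0 k + delta)
         `^ (- (2 - alpha))).
Proof.
pose p j k : R := (2 * kappa ^+ 2 + g 0 j + g 0 k + delta) `^ (- (2 - alpha)).
pose C : R := (1 - alpha) * Gamma (1 - alpha).
have pC j k : p j k = p k j by rewrite /p; congr (_ `^ _); ring.
have entry j k : u j 0 * u k 0 * ('D_(dir R i) (@A_mx R alpha delta kappa n) g) j k
    = - C * ((j == i)%:R * (u j 0 * (u k 0 * p j k))
             + (k == i)%:R * (u k 0 * (u j 0 * p k j))).
  rewrite derive_mx; last exact: derivable_A_mx.
  rewrite mxE (A_mx_derive j k i).2 -/(p j k) (pC k j) /C; ring.
have pick (F : 'I_n -> R) : \sum_j (j == i)%:R * F j = F i.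
  rewrite (bigD1 i)//= eqxx mul1r big1 ?addr0// => j /negbTE->.
  by rewrite mul0r.
rewrite mxquadE.
under eq_bigr do under eq_bigr do rewrite entry.
under eq_bigr do rewrite -mulr_sumr big_split/= -mulr_sumr pick.
rewrite -mulr_sumr big_split/= pick -!mulr_sumr -/(p i) /C.
ring.
Qed.

End gradient.

Theorem propositionC1 (R : realType) (n : nat) (alpha beta delta kappa : R)
    (g : 'rV[R]_n)
    (beta_gt0 : 0 < beta) (kappa_gt0 : 0 < kappa)
    (delta_gt : - (2 * kappa ^+ 2) < delta)
    (alpha_lt1 : alpha < 1) (alpha_lt_beta : alpha < beta)
    (alpha_lt_2beta1 : alpha < 2 * beta - 1)
    (g_gt0 : forall j : 'I_n, 0 < g 0 j)
    (g_inj : forall j k : 'I_n, j != k -> g 0 j != g 0 k) :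
  let a := a_coef alpha beta delta kappa in
  let b := @b_vec R alpha beta delta kappa n in
  let A := @A_mx R alpha delta kappa n in
  let u := u_vec alpha beta delta kappa g in
  let J := @J_hat R alpha beta delta kappa n in
  [/\ A g \in unitmx,
      (exists c : 'cV[R]_n, objective alpha beta delta kappa g c = (J g)%:E)
        /\ J g = a - ((b g)^T *m invmx (A g) *m b g) 0 0,
      [/\ a = Gamma (2 * beta - 1 - alpha)
              * (2 * kappa ^+ 2 + delta) `^ (- (2 * beta - 1 - alpha)),
          forall j : 'I_n,
            b g j 0 = Gamma (beta - alpha)
              * (2 * kappa ^+ 2 + g 0 j + delta) `^ (- (beta - alpha))
        & forall j k : 'I_n,
            A g j k = Gamma (1 - alpha)
              * (2 * kappa ^+ 2 + g 0 j + g 0 k + delta) `^ (- (1 - alpha))],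
      differentiable J g
    & forall i : 'I_n,
        [/\ derivable b g (dir R i),
            derivable A g (dir R i),
            'D_(dir R i) J g
              = - 2 * (('D_(dir R i) b g)^T *m u) 0 0
                + (u^T *m 'D_(dir R i) A g *m u) 0 0
          & 'D_(dir R i) J g
              = 2 * (beta - alpha) * Gamma (beta - alpha)
                  * (2 * kappa ^+ 2 + g 0 i + delta) `^ (- (beta - alpha + 1))
                  * u i 0
                - 2 * (1 - alpha) * Gamma (1 - alpha) * u i 0
                  * \sum_(k < n) u k 0
                      * (2 * kappa ^+ 2 + g 0 i + g 0 k + delta)
                          `^ (- (2 - alpha))]].
Proof.
move=> a b A u J.
have near_ok := @filterI _ _ (nbhs_filter g) _ _
  (near_gt0 g_gt0) (near_distinct g_inj).
have near_unit : \forall h \near g, A h \in unitmx.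
  by apply: (@filterS _ _ (nbhs_filter g) _ _ _ near_ok) => h [h0 hinj];
    exact: A_mx_unit.
have symA : (A g)^T = A g by exact: A_mx_sym.
have dA j k : differentiable (fun h => A h j k) g.
  by have [] := A_mx_derive delta_gt alpha_lt1 g_gt0 j k j.
have db j : differentiable (fun h => b h j 0) g.
  by have [] := b_vec_derive delta_gt alpha_lt_beta g_gt0 j j.
have formD v := derive_solve_form v near_unit symA dA db.
pose q h := ((b h)^T *m invmx (A h) *m b h) 0 0.
have dq : differentiable q g by have [] := formD 0.
have nearJ : \forall h \near g, a - q h = J h.
  apply: (@filterS _ _ (nbhs_filter g) _ _ _ near_ok) => h [h0 hinj].
  by rewrite /J (objective_min delta_gt alpha_lt1 alpha_lt_beta
                 alpha_lt_2beta1 h0 hinj).2.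
have DJ v : 'D_v J g = - 2 * (('D_v b g)^T *m u) 0 0
                       + (u^T *m 'D_v A g *m u) 0 0.
  rewrite -(near_eq_derive _ nearJ) deriveB//; last exact: diff_derivable.
  by rewrite derive_cst (formD v).2 add0r opprB addrC mulNr.
have [objE JE] := objective_min delta_gt alpha_lt1 alpha_lt_beta
  alpha_lt_2beta1 g_gt0 g_inj.
split.
- exact: nbhs_singleton near_unit.
- by split => //; exists u.
- split; first exact: a_coefE.
  + by move=> j; exact: b_vecE.
  + by move=> j k; exact: A_mxE.
- apply: near_eq_differentiable nearJ _.
  by apply: differentiableB.
- move=> i; split; [exact: derivable_b_vec|exact: derivable_A_mx|exact: DJ|].
  rewrite DJ derive_b_vec_form// derive_A_mx_form//; ring.
Qed.
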